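(* Let $\Gamma$ be an additive Abelian group with $|\Gamma|$ odd, and let $G$ be an unbalanced, $\Gamma$-flow admissible signed graph with $n$ vertices and $m$ edges. Then for any linear order $\prec$ on $E(G)$, $$F_0(G,x)=a_0x^{m-n}-a_1x^{m-n-1}+a_2x^{m-n-2}-\cdots+(-1)^{m-n}a_{m-n},$$ where, for any $i\in\{0,1,\dots,m-n\}$, $a_i$ is the number of edge subsets of $G$ having $i$ edges and containing no broken bond as a subset. In particular: 1) $a_i>0$ for every $i=0,1,2,\dots,m-n$; 2) $a_0=1$; 3) $a_1=m-\sigma(G)$, where $\sigma(G)$ is the number of those edges $e$ for which there is an edge $e'$ with $e\prec e'$ satisfying one of the following three conditions: (i) one of $e$ and $e'$ is a cut edge and $G-\{e,e'\}$ has a balanced component; (ii) $\{e,e'\}$ is an edge cut and $G-\{e,e'\}$ has a balanced component; (iii) $\{e,e'\}$ is contained in a component $\omega$ of $G$ and $\omega-\{e,e'\}$ is balanced.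
   Context: Graphs are finite and may contain parallel edges and loops. A signed graph is a graph $G$ in which each edge is positive or negative. A circuit is a connected 2-regular graph (a loop is a circuit of length 1); it is unbalanced if it has an odd number of negative edges. A (sub)graph is unbalanced if it contains an unbalanced circuit, and balanced otherwise. $G-F$ is obtained from $G$ by deleting the edges in $F$ (keeping all vertices). A cut edge is an edge whose deletion increases the number of components; an edge cut is the set of all edges between a vertex set and its complement. Orientation and flows: a positive edge is oriented in the usual way. A negative edge consists of two half-edges, one at each end, and is oriented either extroverted (incoming at both ends) or introverted (outgoing at both ends). Given a fixed orientation of $G$, a $\Gamma$-flow ($\Gamma$ an additive Abelian group) is a map $\mathbf f:E(G)\to\Gamma$ such that at every vertex $v$ the sum of the values of $\mathbf f$ over the edges and half-edges incoming at $v$ equals the sum over those outgoing at $v$ (a loop contributes at $v$ through both of its ends). It is nowhere-zero if $\mathbf f(e)\neq0$ for all $e$. The number of nowhere-zero $\Gamma$-flows does not depend on the orientation. $G$ is $\Gamma$-flow admissible if it admits at least one nowhere-zero $\Gamma$-flow. $F_0(G,x)$ is the polynomial (known to exist) such that, for every Abelian group $\Gamma$ of odd order $k$, the number of nowhere-zero $\Gamma$-flows in $G$ equals $F_0(G,k)$. Bonds: for $X\subseteq V(G)$, $[X,X^C]$ is the set of edges between $X$ and its complement, $G[X]$ the induced subgraph and $E(X)$ its edge set. A non-empty set $B\subseteq E(G)$ is a cut if $B=[X,X^C]\cup E_X$ with $X\subseteq V(G)$ non-empty and $E_X\subseteq E(X)$ minimal such that $G[X]-E_X$ is balanced. A bond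 is a minimal cut (with respect to inclusion). A broken bond is a set $B\setminus\{B_{\max}\}$, where $B$ is a bond and $B_{\max}$ is its maximum element with respect to $\prec$ (a broken bond may be empty).
   Formalization: ''Unbalanced'' is strengthened: every component of G (isolated vertices included) is assumed unbalanced; with b>0 balanced components F_0 has degree m-n+b, so the formula fails (e.g. a vertex with two negative loops plus an isolated vertex has F_0=x-1, not 1). *)

(* Defs.v *)
From mathcomp Require Import all_boot all_order all_algebra.
From Stdlib Require Import ClassicalEpsilon.

Set Implicit Arguments.
Unset Strict Implicit.
Unset Printing Implicit Defensive.

Import GRing.Theory.
Local Open Scope ring_scope.

(* The two half-edges of an edge e are (e, false) and (e, true), and
   [endv h] is the vertex at which the half-edge h is attached.  Loops and
   parallel edges are allowed; the order of the two half-edges of an edge is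
   an artefact of the encoding, and no definition below depends on it. *)
Record signed_graph := SignedGraph {
  vertex : finType;
  edge : finType;
  endv : edge * bool -> vertex;
  negative : pred edge
}.

Section SignedGraph.

Variable G : signed_graph.
Local Notation V := (vertex G).
Local Notation E := (edge G).

(* Edge sets F stand for the spanning subgraphs (V, F), so that G - S is
   represented by [~: S]. *)

Definition adj (F : {set E}) : rel V := fun u v =>
  [exists e in F, exists b, (endv (e, b) == u) && (endv (e, ~~ b) == v)].

Definition component_of (F : {set E}) (v : V) : {set V} :=
  [set w | connect (adj F) v w].

Definition components (F : {set E}) : {set {set V}} :=
  [set component_of F v | v : V].

Definition edges_in (F : {set E}) (X : {set V}) : {set E} :=
  [set e in F | [forall b, endv (e, b) \in X]].

(* A loop of C at v is counted twice, once for each of its half-edges. *)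
Definition degree (C : {set E}) (v : V) : nat :=
  #|[set h : E * bool | (h.1 \in C) && (endv h == v)]|.

Definition support_vertices (C : {set E}) : {set V} :=
  [set v | [exists e in C, exists b, endv (e, b) == v]].

Definition circuit (C : {set E}) : bool :=
  [&& C != set0,
      [forall v in support_vertices C, degree C v == 2%N] &
      [forall u in support_vertices C, forall v in support_vertices C,
         connect (adj C) u v]].

Definition unbalanced_circuit (C : {set E}) : bool :=
  circuit C && odd #|[set e in C | negative e]|.

(* Balance only depends on the edges of a subgraph. *)
Definition unbalanced (F : {set E}) : bool :=
  [exists C : {set E}, (C \subset F) && unbalanced_circuit C].

Definition balanced (F : {set E}) : bool := ~~ unbalanced F.

Definition has_balanced_component (F : {set E}) : bool :=
  [exists W in components F, balanced (edges_in F W)].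

(* [o h] means that the half-edge h is incoming at its vertex. *)
Definition orientation (o : E * bool -> bool) : Prop :=
  forall e : E, if negative e then o (e, true) = o (e, false)
                else o (e, true) = ~~ o (e, false).

Definition is_flow (Gamma : finZmodType) (o : E * bool -> bool)
    (f : {ffun E -> Gamma}) : bool :=
  [forall v : V,
     \sum_(h : E * bool | (endv h == v) && o h) f h.1
     == \sum_(h : E * bool | (endv h == v) && ~~ o h) f h.1].

Definition nowhere_zero_flows (Gamma : finZmodType) (o : E * bool -> bool) :
    {set {ffun E -> Gamma}} :=
  [set f | is_flow o f && [forall e, f e != 0]].

Definition flow_admissible (Gamma : finZmodType) : Prop :=
  exists2 o, orientation o & nowhere_zero_flows Gamma o != set0.

Definition is_F0 (P : {poly int}) : Prop :=
  forall (Gamma : finZmodType) (o : E * bool -> bool),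
    odd #|Gamma| -> orientation o ->
    (#|nowhere_zero_flows Gamma o|)%:R = P.[(#|Gamma|)%:R].

(* [is_F0] has at most one solution, as a polynomial is determined by its
   values at the odd positive integers.  That it has one is not assumed
   anywhere: a proof that [F0 G] equals a given polynomial has to establish
   it. *)
Definition F0 : {poly int} := epsilon (inhabits 0) is_F0.

Definition boundary (X : {set V}) : {set E} :=
  [set e | (endv (e, false) \in X) != (endv (e, true) \in X)].

Definition edge_cut (S : {set E}) : bool :=
  [exists X : {set V}, S == boundary X].

Definition cut_edge (e : E) : bool :=
  (#|components [set: E]| < #|components (~: [set e])|)%N.

(* S is minimal with respect to inclusion. *)
Definition minimal_balancing (X : {set V}) (S : {set E}) : bool :=
  minset (fun T : {set E} => (T \subset edges_in [set: E] X)
                             && balanced (edges_in [set: E] X :\: T)) S.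

Definition cut (B : {set E}) : bool :=
  (B != set0) &&
  [exists X : {set V}, exists S : {set E},
     [&& X != set0, minimal_balancing X S & B == boundary X :|: S]].

Definition bond (B : {set E}) : bool := minset cut B.

Definition strict_linear_order (prec : rel E) : Prop :=
  [/\ irreflexive prec, transitive prec
    & forall e e' : E, e != e' -> prec e e' || prec e' e].

Definition broken_bond (prec : rel E) (D : {set E}) : bool :=
  [exists B : {set E}, exists bmax in B,
     [&& bond B, [forall e in B, (e != bmax) ==> prec e bmax]
       & D == B :\ bmax]].

(* The coefficients a_i of the broken bond expansion. *)
Definition nbb_count (prec : rel E) (i : nat) : nat :=
  #|[set S : {set E} | (#|S| == i)
       && [forall D : {set E}, broken_bond prec D ==> ~~ (D \subset S)]]|.

(* For distinct e and e', the disjunction of conditions (i), (ii) and (iii)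
   in the definition of sigma(G); in (iii), W is the vertex set of omega. *)
Definition sigma_pair (e e' : E) : bool :=
  let G' := ~: [set e; e'] in
  [|| (cut_edge e || cut_edge e') && has_balanced_component G',
      edge_cut [set e; e'] && has_balanced_component G'
    | [exists W in components [set: E],
         ([set e; e'] \subset edges_in [set: E] W)
         && balanced (edges_in G' W)]].

Definition sigma (prec : rel E) : nat :=
  #|[set e | [exists e', prec e e' && sigma_pair e e']]|.

End SignedGraph.

(* Main.v *)
(* For an odd group, a flow that vanishes on all edges of a cut but one also
   vanishes on that edge (sum the flow condition over X after switching), and the
   flows on G - S number k^(m - n - |S|) as soon as G - S has no balanced
   component, because 2 is invertible.  Inclusion-exclusion writes the number of
   nowhere-zero flows as the sum over S of (-1)^|S| times the number of flows on
   G - S; by the first fact the sets S containing a broken bond cancel in pairs,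
   as in Whitney's broken circuit theorem, and by the second each of the others
   contributes (-1)^|S| k^(m - n - |S|).  Positivity follows from an exchange
   argument in the bond matroid, and a_1 from the fact that S contains a bond if
   and only if G - S has a balanced component. *)
Require Import Defs.
From mathcomp Require Import all_boot all_order all_algebra.
From Stdlib Require Import ClassicalEpsilon.

Set Implicit Arguments.
Unset Strict Implicit.
Unset Printing Implicit Defensive.

Import GRing.Theory.
Local Open Scope ring_scope.

Lemma big_half_edges (E : finType) (R : Type) (idx : R)
    (op : Monoid.com_law idx) (P : pred E) (F : E * bool -> R) :
  \big[op/idx]_(h | P h.1) F h
  = \big[op/idx]_(e | P e) op (F (e, false)) (F (e, true)).
Proof.
rewrite (eq_bigl (fun h => P h.1 && true)); last by move=> h; rewrite andbT.
rewrite (eq_bigr (fun h => F (h.1, h.2))); last by case.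
rewrite -(pair_big_dep P (fun _ _ => true) (fun e b => F (e, b))) /=.
by apply: eq_bigr => e _; rewrite big_bool Monoid.mulmC.
Qed.

(** * Edge sets modulo 2, the signed double cover and balance *)

Section Balance.

Variable G : signed_graph.
Local Notation V := (vertex G).
Local Notation E := (edge G).
Implicit Types (F C D K : {set E}) (u v w : V).

Definition sdiff D K : {set E} := [set e | (e \in D) (+) (e \in K)].

Definition odd_degree D v := odd (degree D v).

Definition odd_negative D := odd #|[set e in D | negative e]|.

Lemma odd_degreeE D v :
  odd_degree D v = \big[addb/false]_(h : E * bool | endv h == v) (h.1 \in D).
Proof.
rewrite /odd_degree /degree -sum1dep_card (big_morph odd oddD (erefl _)).
rewrite big_mkcondl /= big_mkcond [RHS]big_mkcond; apply: eq_bigr => h _.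
by case: eqP => //; case: (_ \in _).
Qed.

Lemma odd_negativeE D :
  odd_negative D = \big[addb/false]_(e | negative e) (e \in D).
Proof.
rewrite /odd_negative -sum1dep_card (big_morph odd oddD (erefl _)).
rewrite big_mkcond [RHS]big_mkcond; apply: eq_bigr => e _.
by case: negative; case: (_ \in _).
Qed.

Lemma odd_degree_sdiff D K v :
  odd_degree (sdiff D K) v = odd_degree D v (+) odd_degree K v.
Proof.
by rewrite !odd_degreeE -big_split; apply: eq_bigr => h _; rewrite inE.
Qed.

Lemma odd_negative_sdiff D K :
  odd_negative (sdiff D K) = odd_negative D (+) odd_negative K.
Proof.
by rewrite !odd_negativeE -big_split; apply: eq_bigr => h _; rewrite inE.
Qed.

Lemma odd_degree1 e b v :
  odd_degree [set e] v = (v == endv (e, b)) (+) (v == endv (e, ~~ b)).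
Proof.
rewrite odd_degreeE big_mkcond (big_half_edges _ xpredT) (bigD1 e) //= big1.
  rewrite set11 addbF !(eq_sym v).
  by case: b => /=; do 2! case: ifP => //=.
by move=> e' /negPf ne; rewrite !inE ne; do 2! case: ifP.
Qed.

Lemma odd_negative1 e : odd_negative [set e] = negative e.
Proof.
rewrite odd_negativeE big_mkcond (bigD1 e) //= big1; last first.
  by move=> e' /negPf ne; rewrite inE ne; case: ifP.
by rewrite set11 addbF; case: negative.
Qed.

(** Both sides count, modulo 2, the half-edges of [D] at vertices satisfying [s]. *)
Lemma odd_handshake D (s : V -> bool) :
  \big[addb/false]_(v | s v) odd_degree D v
  = \big[addb/false]_(e in D) (s (endv (e, false)) (+) s (endv (e, true))).
Proof.
rewrite -(big_half_edges _ (mem D) (fun h => s (endv h))).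
under eq_bigr do rewrite odd_degreeE.
rewrite (exchange_big_dep xpredT) //= [RHS]big_mkcond; apply: eq_bigr => h _.
rewrite (eq_bigl (fun v => (v == endv h) && s (endv h))); last first.
  move=> v; rewrite eq_sym andbC; case: eqP => //= <-; exact: erefl.
case: (boolP (s (endv h))) => hs; last by rewrite big_pred0 ?if_same // => v; rewrite andbF.
by rewrite (eq_bigl (pred1 (endv h))) ?big_pred1_eq; [case: (_ \in _) | move=> v; rewrite andbT].
Qed.

Lemma circuit_even C v : circuit C -> odd_degree C v = false.
Proof.
case/and3P=> _ /'forall_implyP hdeg _; rewrite /odd_degree.
have [/hdeg/eqP -> //|nv] := boolP (v \in support_vertices C).
suff -> : degree C v = 0%N by [].
apply/eqP; rewrite cards_eq0; apply/eqP/setP=> -[e b]; rewrite !inE /=.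
apply/andP => -[eC ev]; case/negP: nv; rewrite inE.
by apply/existsP; exists e; rewrite eC; apply/existsP; exists b.
Qed.

(** A switching function: changing the signs of the edges between the two classes of [s] makes every
    edge of [F] positive. *)
Definition potential F (s : V -> bool) :=
  forall e, e \in F -> negative e = s (endv (e, false)) (+) s (endv (e, true)).

Lemma balancedS F K : F \subset K -> balanced K -> balanced F.
Proof.
move=> FK; apply: contra => /existsP[C /andP[CF uC]].
by apply/existsP; exists C; rewrite uC (subset_trans CF).
Qed.

(** The handshake identity turns the parity of the negative edges of a circuit into a sum of its
    degrees modulo 2, which are all even. *)
Lemma potential_balanced F s : potential F s -> balanced F.
Proof.
move=> pot; apply/negP => /existsP[C /and3P[CF cC]].
rewrite -[odd _]/(odd_negative C) odd_negativeE big_mkcond.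
rewrite (eq_bigr (fun e => if e \in C then
   s (endv (e, false)) (+) s (endv (e, true)) else false)).
  rewrite -big_mkcond -odd_handshake big1 // => v _; exact: circuit_even.
move=> e _; case: (boolP (e \in C)) => [eC|_]; last by case: ifP.
by rewrite -(pot e (subsetP CF e eC)); case: negative.
Qed.

(* A minimal such set F has no proper nonempty even subset, so it is connected,
   and the odd-degree sets of the subsets of F - e0 are distinct; as they have
   even size, this gives |F| <= |V(F)|, and all degrees equal 2. *)
Lemma unbalanced_of_even D :
  (forall v, odd_degree D v = false) -> odd_negative D -> unbalanced D.
Proof.
move=> evenD oddD0.
pose p F := [forall v, odd_degree F v == false] && odd_negative F.
have pD : p D by rewrite /p oddD0 andbT; apply/forallP => v; rewrite evenD.
have [F /minsetP[/andP[/forallP evF oF] minF] FD] := minset_exists pD.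
have {}evF v : odd_degree F v = false by apply/eqP.
apply/existsP; exists F; rewrite FD /unbalanced_circuit [odd _]oF andbT.
(* For even [K], either [K] or its complement in [F] has an odd number of negative edges, and
   minimality makes that one equal to [F]. *)
have subE K : K \subset F -> (forall v, odd_degree K v = false) ->
    K = set0 \/ K = F.
  move=> KF evK; case oK: (odd_negative K).
    by right; apply: minF => //; rewrite /p oK andbT; apply/forallP => v; rewrite evK.
  left; have dF : sdiff F K = F.
    apply: minF.
      rewrite /p odd_negative_sdiff oF oK andbT; apply/forallP => v.
      by rewrite odd_degree_sdiff evF evK.
    apply/subsetP => e; rewrite inE; case eF: (e \in F) => //=.
    by move=> /(subsetP KF); rewrite eF.
  apply/setP => e; rewrite inE; apply/negP => eK.
  by have := subsetP KF e eK; rewrite -dF inE (subsetP KF) // eK.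
have Fn0 : F != set0.
  apply/eqP => F0; move: oF; rewrite F0 odd_negativeE big1 // => e; by rewrite inE.
have suppP v : reflect (exists2 h : E * bool, h.1 \in F & endv h = v)
    (v \in support_vertices F).
  rewrite inE; apply: (iffP exists_inP) => [[e eF /existsP[b /eqP <-]]|[[e b] eF <-]].
    by exists (e, b).
  by exists e => //; apply/existsP; exists b.
have deg_supp v : v \in support_vertices F -> (1 < degree F v)%N.
  case/suppP=> h hF hv; have := evF v; rewrite /odd_degree.
  have : (0 < degree F v)%N.
    by rewrite /degree; apply/card_gt0P; exists h; rewrite inE hF hv eqxx.
  by case: (degree F v) => [|[]].
have deg_nsupp v : v \notin support_vertices F -> degree F v = 0%N.
  move=> nv; apply/eqP; rewrite cards_eq0; apply/eqP/setP=> h; rewrite !inE.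
  by apply/andP => -[hF /eqP hv]; case/negP: nv; apply/suppP; exists h.
rewrite /circuit Fn0 /=; apply/andP; split; last first.
  apply/forall_inP=> u /suppP[[e0 b0] e0F uE]; apply/forall_inP => v /suppP[[e b] eF vE].
  have adj_ends e1 b1 w : e1 \in F -> connect (adj F) w (endv (e1, b1)) ->
      connect (adj F) w (endv (e1, ~~ b1)).
    move=> e1F cw; apply: (connect_trans cw); apply: connect1.
    by apply/exists_inP; exists e1 => //; apply/existsP; exists b1; rewrite !eqxx.
  (* The edges in the component of [u] form a nonempty even subset of [F], hence all of [F]. *)
  pose K := [set e in F | connect (adj F) u (endv (e, false))].
  have KE e1 b1 : e1 \in F -> connect (adj F) u (endv (e1, b1)) = (e1 \in K).
    move=> e1F; rewrite inE e1F /=; case: b1 => //.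
    by apply/idP/idP; apply: adj_ends.
  have KF : K \subset F by apply/subsetP => e1; rewrite inE => /andP[].
  have evK w : odd_degree K w = false.
    case cw: (connect (adj F) u w).
      rewrite -(evF w) !odd_degreeE; apply: eq_bigr => -[e1 b1] /eqP hw /=.
      case e1F: (e1 \in F); first by rewrite -(KE e1 b1 e1F) hw.
      by rewrite inE e1F.
    rewrite odd_degreeE big1 // => -[e1 b1] /eqP hw /=.
    case e1F: (e1 \in F); first by rewrite -(KE e1 b1 e1F) hw.
    by rewrite inE e1F.
  have [K0|KeF] := subE K KF evK.
    by have := KE e0 b0 e0F; rewrite uE connect0 K0 inE.
  by rewrite -vE KE ?KeF.
have [e0 e0F] := set0Pn _ Fn0.
pose v0 := endv (e0, false).
have v0S : v0 \in support_vertices F by apply/suppP; exists (e0, false).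
have cardF : (#|F| <= #|support_vertices F|)%N.
  (* The parity at [v0] is determined by the others. Two sets with the same parities off [v0] differ
     by an even set avoiding [e0], which [subE] makes empty. *)
  pose oset K := [set v | odd_degree K v] :\ v0.
  have : (#|powerset (F :\ e0)| <= #|powerset (support_vertices F :\ v0)|)%N.
    have <- : #|oset @: powerset (F :\ e0)| = #|powerset (F :\ e0)|.
      apply: card_in_imset => K K'; rewrite !inE => KF KF' eqo.
      have ev v : v != v0 -> odd_degree (sdiff K K') v = false.
        move=> nv; rewrite odd_degree_sdiff.
        by move/setP/(_ v): eqo; rewrite !inE nv /= => ->; rewrite addbb.
      have dF : sdiff K K' \subset F :\ e0.
        apply/subsetP => e; rewrite inE; case eK: (e \in K) => /=.
          by move=> _; apply: (subsetP KF).
        exact: (subsetP KF').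
      have [|v|d0|dE] := subE (sdiff K K').
      - by apply: (subset_trans dF); apply: subsetDl.
      - have [->|/ev//] := eqVneq v v0.
        have := odd_handshake (sdiff K K') xpredT.
        rewrite (bigD1 v0) //= [in X in _ (+) X]big1 => [|w /ev//].
        by rewrite addbF => ->; rewrite big1.
      - apply/setP => e; move/setP/(_ e): d0; rewrite !inE.
        by do 2!case: (_ \in _).
      - by move: (subsetP dF e0); rewrite dE e0F !inE eqxx => /(_ isT).
    apply: subset_leq_card; apply/subsetP => _ /imsetP[K KF ->].
    rewrite inE; apply: setSD; apply/subsetP => v; rewrite inE.
    move=> oK; apply: contraT => /deg_nsupp dv.
    suff: (degree K v <= degree F v)%N.
      by rewrite dv leqn0 => /eqP dK; move: oK; rewrite /odd_degree dK.
    apply: subset_leq_card; apply/subsetP => h; rewrite !inE => /andP[hK ->].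
    rewrite andbT; move: KF; rewrite inE => /subsetP/(_ _ hK).
    by rewrite inE => /andP[].
  rewrite !card_powerset leq_exp2l // (cardsD1 e0 F) e0F.
  by rewrite (cardsD1 v0 (support_vertices F)) v0S.
have sum_deg : (\sum_(v in support_vertices F) degree F v = 2 * #|F|)%N.
  transitivity (\sum_v degree F v)%N.
    rewrite big_mkcond; apply: eq_bigr => v _; case: ifP => // /negbT.
    by move/deg_nsupp.
  transitivity (\sum_v \sum_(h : E * bool | h.1 \in F) (endv h == v))%N.
    apply: eq_bigr => v _; rewrite /degree -sum1dep_card big_mkcondr.
    by apply: eq_bigr => h _; case: eqP.
  rewrite exchange_big (eq_bigr (fun=> 1%N)) => [|h _].
    by rewrite (big_half_edges _ (fun e => e \in F)) /= sum_nat_const mulnC.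
  rewrite (bigD1 (endv h)) //= eqxx big1 // => v; rewrite eq_sym.
  by move/negPf ->.
apply/forall_inP => v vS; rewrite eqn_leq deg_supp // andbT leqNgt.
apply/negP => dv.
have : (\sum_(v in support_vertices F) 2 < 2 * #|F|)%N.
  rewrite -sum_deg (bigD1 v) //= [X in (_ < X)%N](bigD1 v) //= -addSn leq_add //.
  by apply: leq_sum => w /andP[/deg_supp].
by rewrite sum_nat_const mulnC ltn_mul2l /= ltnNge cardF.
Qed.

(* Adjacency in the double cover in which the sheets are exchanged along the
   negative edges. *)
Definition cover_adj F : rel (V * bool) := fun x y =>
  [exists e in F, exists b, [&& endv (e, b) == x.1, endv (e, ~~ b) == y.1
     & y.2 == x.2 (+) negative e]].

Lemma cover_adjP F x y :
  reflect (exists e b, [/\ e \in F, endv (e, b) = x.1, endv (e, ~~ b) = y.1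
     & y.2 = x.2 (+) negative e]) (cover_adj F x y).
Proof.
apply: (iffP exists_inP) => [[e eF /existsP[b /and3P[/eqP ? /eqP ? /eqP ?]]]|].
  by exists e, b.
move=> [e [b [eF <- <- ->]]]; exists e => //.
by apply/existsP; exists b; rewrite !eqxx.
Qed.

Lemma cover_sym F : connect_sym (cover_adj F).
Proof.
apply: sym_connect_sym => x y.
by apply/cover_adjP/cover_adjP => -[e [b [eF h1 h2 h3]]]; exists e, (~~ b);
  rewrite negbK h3 -addbA addbb addbF.
Qed.

Lemma adj_sym F : connect_sym (adj F).
Proof.
apply: sym_connect_sym => x y.
by apply/exists_inP/exists_inP => -[e eF /existsP[b /andP[h1 h2]]];
  exists e => //; apply/existsP; exists (~~ b); rewrite negbK h1 h2.
Qed.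

(** Exchanging the two sheets is an automorphism of the cover. *)
Lemma cover_flip F u s v t :
  connect (cover_adj F) (u, s) (v, t) ->
  connect (cover_adj F) (u, ~~ s) (v, ~~ t).
Proof.
case/connectP=> p; elim: p u s => [|[w r] p IH] u s /=.
  by move=> _ [-> ->]; apply: connect0.
case/andP=> /cover_adjP[e [b [eF h1 h2 h3]]] pp lp.
apply: (connect_trans _ (IH _ _ pp lp)); apply: connect1; apply/cover_adjP.
by exists e, b; split=> //=; move: h3 => /= ->; rewrite addNb.
Qed.

Lemma cover_lift F u v s :
  connect (adj F) u v -> exists t, connect (cover_adj F) (u, s) (v, t).
Proof.
case/connectP=> p; elim: p u s => [|w p IH] u s /=.
  by move=> _ ->; exists s; apply: connect0.
case/andP=> /exists_inP[e eF /existsP[b /andP[/eqP h1 /eqP h2]]] pp lp.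
have [t ct] := IH _ (s (+) negative e) pp lp; exists t.
apply: (connect_trans _ ct); apply: connect1; apply/cover_adjP.
by exists e, b.
Qed.

(** [D] is the sum modulo 2 of the edges of the projected walk: degree parities telescope to its
    ends, and negative edges account for the change of sheet. *)
Lemma cover_connect_edges F x y :
  connect (cover_adj F) x y ->
  exists D, [/\ D \subset F,
    forall w, odd_degree D w = (w == x.1) (+) (w == y.1)
    & odd_negative D = x.2 (+) y.2].
Proof.
case/connectP=> p; elim: p x => [|z p IH] x /=.
  move=> _ ->; exists set0; split; first exact: sub0set.
    by move=> w; rewrite addbb odd_degreeE big1 // => h _; rewrite inE.
  by rewrite addbb odd_negativeE big1 // => h _; rewrite inE.
case/andP=> /cover_adjP[e [b [eF h1 h2 h3]]] pp lp.
have [D [DF dD nD]] := IH _ pp lp; exists (sdiff [set e] D); split.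
- apply/subsetP => e'; rewrite !inE; case: eqP => [-> //|_] /=.
  exact: (subsetP DF).
- move=> w; rewrite odd_degree_sdiff dD (odd_degree1 e b) h1 h2.
  by rewrite addbA -(addbA (w == x.1)) addbb addbF.
- by rewrite odd_negative_sdiff odd_negative1 nD h3; case: negative x.2 y.2 => -[] [].
Qed.

Lemma balanced_cover F u :
  balanced F -> ~~ connect (cover_adj F) (u, false) (u, true).
Proof.
move=> balF; apply/negP => /cover_connect_edges[D [DF dD nD]].
case/negP: (balancedS DF balF); apply: unbalanced_of_even; last exact: nD.
by move=> v; rewrite dD addbb.
Qed.

(** If both lifts of [v] were reachable, flipping one of the walks would connect the two lifts of
    [r]. *)
Lemma cover_sheet F r v t :
  ~~ connect (cover_adj F) (r, false) (r, true) ->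
  connect (cover_adj F) (r, false) (v, t) ->
  connect (cover_adj F) (r, false) (v, true) = t.
Proof.
move=> nr; case: t => // cf; apply: contraNF nr => ct.
by apply: (connect_trans ct); rewrite cover_sym; apply: cover_flip cf.
Qed.

Lemma cover_potential F r e :
  ~~ connect (cover_adj F) (r, false) (r, true) ->
  e \in F -> connect (adj F) r (endv (e, false)) ->
  negative e = connect (cover_adj F) (r, false) (endv (e, false), true)
           (+) connect (cover_adj F) (r, false) (endv (e, true), true).
Proof.
move=> nr eF /(cover_lift false)[t ct].
rewrite (cover_sheet nr ct).
suff /(cover_sheet nr) -> : connect (cover_adj F) (r, false)
    (endv (e, true), t (+) negative e) by rewrite addbA addbb.
apply: (connect_trans ct); apply: connect1; apply/cover_adjP.
by exists e, false.
Qed.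

(** Harary's switching criterion: balance makes the sheet reached from a base point well defined,
    and this sheet is the switching function. *)
Lemma balanced_potential F : balanced F -> exists s, potential F s.
Proof.
move=> balF.
(* One base point per component, so that both ends of an edge refer to the same lift. *)
exists (fun v => connect (cover_adj F) (fingraph.root (adj F) v, false) (v, true)).
move=> e eF; have rE : fingraph.root (adj F) (endv (e, true)) = fingraph.root (adj F) (endv (e, false)).
  apply/eqP; rewrite root_connect; last exact: adj_sym.
  apply: connect1; apply/exists_inP; exists e => //.
  by apply/existsP; exists true; rewrite !eqxx.
rewrite rE; apply: cover_potential => //; first exact: balanced_cover.
by rewrite adj_sym; apply: connect_root.
Qed.

Lemma unbalanced_component_cover F u :
  ~~ balanced (edges_in F (component_of F u)) ->
  connect (cover_adj F) (u, false) (u, true).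
Proof.
apply: contraR => nu; apply: (@potential_balanced _
  (fun v => connect (cover_adj F) (u, false) (v, true))) => e.
by rewrite inE => /andP[eF /forallP/(_ false)]; rewrite inE; apply: cover_potential.
Qed.

End Balance.

(** Translation by [x] permutes the group, so it leaves the sum of all elements unchanged. *)
Lemma mulrn_card (Gamma : finZmodType) (x : Gamma) : x *+ #|Gamma| = 0.
Proof.
apply: (addrI (\sum_(y : Gamma) y)); rewrite addr0 -sumr_const -big_split /=.
by rewrite [RHS](reindex_inj (addIr x)).
Qed.

(** * Flows with values in a group of odd order *)

Section Flows.

Variables (G : signed_graph) (Gamma : finZmodType).
Hypothesis oddG : odd #|Gamma|.
Local Notation V := (vertex G).
Local Notation E := (edge G).
Local Notation chain := {ffun E -> Gamma}.
Implicit Types (F S B X : {set E}) (f : chain) (x : Gamma).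

Lemma double_eq0 x : x + x = 0 -> x = 0.
Proof.
move=> xx; have := mulrn_card x.
by rewrite -(odd_double_half #|Gamma|) oddG -mul2n mulrnDr mulrnA mulr2n xx mul0rn addr0.
Qed.

Lemma exists_half x : exists y, x = y + y.
Proof.
(* If the order is 2h + 1, then (2h + 2) x = x, so (h + 1) x is a half of [x]. *)
exists (x *+ (#|Gamma|./2).+1).
rewrite -mulrnDr addnn doubleS -[x in LHS]addr0 -[in LHS](mulrn_card x).
by rewrite -{1}(odd_double_half #|Gamma|) oddG -mulrS.
Qed.

Definition signed (b : bool) x := if b then - x else x.

Lemma signed_addb b c x : signed (b (+) c) x = signed b (signed c x).
Proof. by case: b c => -[]; rewrite //= opprK. Qed.

Lemma signedB b x y : signed b (x - y) = signed b x - signed b y.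
Proof. by case: b; rewrite //= opprB addrC opprK. Qed.

Lemma signed0 b : signed b 0 = 0.
Proof. by case: b; rewrite //= oppr0. Qed.

Lemma signed_eq0 b x : signed b x = 0 -> x = 0.
Proof. by case: b => //= /eqP; rewrite oppr_eq0 => /eqP. Qed.

Lemma signed_sum b (I : finType) (P : pred I) (F : I -> Gamma) :
  signed b (\sum_(i | P i) F i) = \sum_(i | P i) signed b (F i).
Proof. by case: b => //=; rewrite sumrN. Qed.

Variable o : E * bool -> bool.
Hypothesis oP : orientation o.

Lemma orientation_ends e : o (e, false) (+) o (e, true) = ~~ negative e.
Proof. by have := oP e; case: negative => ->; case: (o _). Qed.

(** Net inflow at each vertex: the boundary operator, whose kernel consists of the flows. *)
Definition bd f : {ffun V -> Gamma} :=
  [ffun v => \sum_(h : E * bool | endv h == v) signed (~~ o h) (f h.1)].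

Lemma is_flowE f : is_flow o f = (bd f == 0).
Proof.
have eqv v : bd f v = \sum_(h : E * bool | (endv h == v) && o h) f h.1
    - \sum_(h : E * bool | (endv h == v) && ~~ o h) f h.1.
  rewrite ffunE (bigID o) /= -sumrN; congr (_ + _); apply: eq_bigr => h.
    by case/andP=> _ ->.
  by case/andP=> _ ->.
apply/forallP/eqP => [fl | b0 v].
  by apply/ffunP => v; rewrite eqv (eqP (fl v)) subrr ffunE.
by rewrite -subr_eq0 -eqv b0 ffunE.
Qed.

Lemma bdB f g : bd (f - g) = bd f - bd g.
Proof.
apply/ffunP => v; rewrite !ffunE -sumrB; apply: eq_bigr => h _.
by rewrite !ffunE signedB.
Qed.

Lemma bd0 : bd 0 = 0.
Proof. by rewrite -(subrr 0) bdB subrr. Qed.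

Definition vanishing S : {set chain} := [set f : chain | [forall e in S, f e == 0]].

Lemma vanishingP S f :
  reflect (forall e, e \in S -> f e = 0) (f \in vanishing S).
Proof.
rewrite inE; apply: (iffP forall_inP) => fS e eS; last by apply/eqP/fS.
by apply/eqP/fS.
Qed.

Lemma vanishingB S f g :
  f \in vanishing S -> g \in vanishing S -> f - g \in vanishing S.
Proof.
move=> /vanishingP fS /vanishingP gS; apply/vanishingP => e eS.
by rewrite !ffunE fS // gS // subr0.
Qed.

Lemma vanishing0 S : 0 \in vanishing S.
Proof. by apply/vanishingP => e _; rewrite ffunE. Qed.

Lemma card_vanishing S : #|vanishing S| = (#|Gamma| ^ (#|E| - #|S|))%N.
Proof.
have -> : (#|E| - #|S| = #|~: S|)%N by rewrite -(cardsC S) addKn.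
rewrite -(card_pffun_on 0 (~: S) Gamma); apply: eq_card => f.
apply/vanishingP/pffun_onP => [fS | [/subsetP fS _] e eS].
  split=> //; apply/subsetP => e; rewrite !inE; apply: contra => /fS ->; exact: eqxx.
apply/eqP/negPn; apply: contraL eS => fe.
by have := fS e; rewrite !inE => -> //.
Qed.

(** The flows on G - S, extended by zero so that all [S] share one space of chains. *)
Definition flows_off S : {set chain} := [set f : chain in vanishing S | is_flow o f].

(** The conservation laws at the vertices of [X] are added with the signs prescribed by the
    switching [s]. *)
Lemma flow_sum f (X : {set V}) (s : V -> bool) : is_flow o f ->
  \sum_(e : E) \sum_(b : bool | endv (e, b) \in X)
     signed (s (endv (e, b)) (+) ~~ o (e, b)) (f e) = 0.
Proof.
rewrite is_flowE => /eqP fl.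
transitivity (\sum_(v in X) signed (s v) (bd f v)); last first.
  by rewrite fl big1 // => v _; rewrite ffunE signed0.
under [RHS]eq_bigr do rewrite ffunE signed_sum.
rewrite (exchange_big_dep (fun h : E * bool => endv h \in X)) /=; last first.
  by move=> v h vX /eqP ->.
rewrite (pair_big_dep xpredT) /=; apply: eq_big => [[e b] //|[e b]] /= eX.
rewrite (big_pred1 (endv (e, b))) ?signed_addb // => v /=.
by rewrite eq_sym; case: eqP => [->|]; rewrite ?eX ?andbF.
Qed.

(** Switch by a potential of the balanced part of G[X] and sum over [X]. Edges of that part cancel,
    and [f] is zero on the rest of [B]. What remains is f(b) up to sign if [b] leaves [X], and twice
    that if [b] lies inside; 2 is invertible. *)
Lemma flow_cut B b f : cut B -> b \in B -> is_flow o f ->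
  f \in vanishing (B :\ b) -> f b = 0.
Proof.
case/andP=> _ /existsP[X /existsP[S /and3P[_ minS /eqP BE]]] bB fl /vanishingP fB.
case/minsetP: minS => /andP[SX balS] minS.
have [s pot] := balanced_potential balS.
have cancel e : endv (e, false) \in X -> endv (e, true) \in X ->
    \sum_(c : bool | endv (e, c) \in X)
       signed (s (endv (e, c)) (+) ~~ o (e, c)) (f e)
    = let x := signed (s (endv (e, false)) (+) ~~ o (e, false)) (f e) in
      if negative e == s (endv (e, false)) (+) s (endv (e, true)) then 0 else x + x.
  move=> e0 e1; rewrite big_mkcond big_bool /= e0 e1.
  have := orientation_ends e.
  case: (s (endv (e, false))) (s (endv (e, true))) (negative e)
    (o (e, false)) (o (e, true)) => -[] [] [] [] //= _;
    by rewrite ?subrr ?addNr.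
have : \sum_(c : bool | endv (b, c) \in X)
     signed (s (endv (b, c)) (+) ~~ o (b, c)) (f b) = 0.
  rewrite -[RHS](flow_sum X s fl) (bigD1 b) //= [X in _ = _ + X]big1 ?addr0 // => e ne.
  case eB: (e \in B).
    by rewrite fB ?inE ?ne // big1 // => c _; rewrite signed0.
  move: eB; rewrite BE !inE => /norP[/negbNE/eqP e01 eS].
  case e0: (endv (e, false) \in X).
    rewrite cancel -?e01 ?e0 // pot ?eqxx //.
    by rewrite !inE eS /=; apply/forallP => -[]; rewrite -?e01 e0.
  by rewrite big1 // => -[]; rewrite -?e01 e0.
move: bB; rewrite BE inE => /orP[|bS].
  rewrite inE big_mkcond big_bool /=.
  by do 2!case: (_ \in X); rewrite //= ?addr0 ?add0r => _ /signed_eq0.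
have := subsetP SX b bS; rewrite !inE /= => /forallP bX.
rewrite cancel //; case: eqP => [negb _|_ /double_eq0/signed_eq0//].
(* If [b] agreed with the potential, [S] without [b] would still balance G[X], against
   minimality. *)
have SbE : S :\ b = S.
  apply: minS; last exact: subsetDl.
  rewrite (subset_trans (subsetDl _ _) SX); apply: (@potential_balanced _ _ s).
    move=> e; rewrite in_setD => /andP[eS eX].
  have [-> //|eb] := eqVneq e b.
  by apply: pot; rewrite in_setD eX andbT; apply: contra eS => eS; rewrite !inE eb.
by move: bS; rewrite -SbE !inE eqxx.
Qed.

Definition single v x : {ffun V -> Gamma} := [ffun w => if w == v then x else 0].

Definition boundaries F : pred {ffun V -> Gamma} :=
  fun y => [exists f in vanishing (~: F), bd f == y].

Lemma boundaries_sub F y z :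
  boundaries F y -> boundaries F z -> boundaries F (y - z).
Proof.
move=> /exists_inP[f fF /eqP <-] /exists_inP[g gF /eqP <-].
by apply/exists_inP; exists (f - g); rewrite ?vanishingB // bdB.
Qed.

Lemma boundaries0 F : boundaries F 0.
Proof.
apply/exists_inP; exists 0; first exact: vanishing0.
by rewrite bd0.
Qed.

Lemma boundaries_add F y z :
  boundaries F y -> boundaries F z -> boundaries F (y + z).
Proof.
move=> yF zF; rewrite -[z]opprK -[- z]sub0r; apply: boundaries_sub => //.
by apply: boundaries_sub => //; apply: boundaries0.
Qed.

(** Sending [x] along the walk moves it from one end to the other, the sheet recording its sign; the
    one-edge contributions telescope. *)
Lemma cover_boundaries F p q x : connect (cover_adj F) p q ->
  boundaries F (single p.1 (signed p.2 x) - single q.1 (signed q.2 x)).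
Proof.
case/connectP=> r; elim: r p => [|p' r IH] p /=.
  by move=> _ ->; rewrite subrr; apply: boundaries0.
case/andP=> /cover_adjP[e [b [eF e1 e2 e3]]] pr lr.
rewrite -[single p.1 _](subrK (single p'.1 (signed p'.2 x))) -addrA.
apply: boundaries_add; last exact: IH.
apply/exists_inP.
(* The sign is chosen so that the half-edge [(e, b)] contributes exactly [signed p.2 x] at [p.1]. *)
pose y := signed (p.2 (+) ~~ o (e, b)) x.
exists [ffun e' => if e' == e then y else 0].
  apply/vanishingP => e'; rewrite inE ffunE; case: eqP => // ->.
  by rewrite eF.
apply/eqP/ffunP => v; rewrite !ffunE big_mkcond (big_half_edges _ xpredT).
rewrite (bigD1 e) //= big1 => [|e' /negPf ne]; last first.
  by rewrite !ffunE /= ne !signed0 !if_same addr0.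
rewrite !ffunE /= eqxx addr0 -e1 -e2 e3 ![v == _]eq_sym /y.
have := orientation_ends e.
case: b e1 e2 {y} => _ _ /=; last rewrite addrC;
do 2! (case: eqP => _; rewrite ?addr0 ?add0r ?oppr0 //);
  case: (p.2) (negative e) (o (e, false)) (o (e, true)) => -[] [] [] //=;
  by rewrite ?opprK // addrC.
Qed.

(** In an unbalanced component the two lifts of [v] are joined, which yields the value x - (-x) = 2x
    at [v] alone; by oddness every group element is some 2x. *)
Lemma boundary_surj F : ~~ has_balanced_component F -> forall y, boundaries F y.
Proof.
move=> hF y.
have -> : y = \sum_v single v (y v).
  apply/ffunP => v; rewrite sum_ffunE (bigD1 v) //= big1 => [|w ne].
    by rewrite ffunE eqxx addr0.
  by rewrite ffunE eq_sym (negPf ne).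
elim/big_ind: _ => [||v _]; [exact: boundaries0|exact: boundaries_add|].
have [x ->] := exists_half (y v).
have /unbalanced_component_cover cv :
    ~~ balanced (edges_in F (component_of F v)).
  apply: contra hF => bal; apply/exists_inP.
  by exists (component_of F v) => //; apply: imset_f.
have := cover_boundaries x cv; rewrite /=.
suff -> : single v x - single v (- x) = single v (x + x) by [].
by apply/ffunP => w; rewrite !ffunE; case: eqP; rewrite ?opprK ?subr0.
Qed.

(** [bd] maps the chains vanishing on [S] onto all vertex functions, and each fibre is a translate
    of the flows. The product form avoids a truncated subtraction of #|V|; the inequality that
    justifies it is deduced from this count. *)
Lemma card_flows_off_mul S : ~~ has_balanced_component (~: S) ->
  (#|flows_off S| * #|Gamma| ^ #|V| = #|Gamma| ^ (#|E| - #|S|))%N.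
Proof.
move/boundary_surj => surj; rewrite -card_vanishing -card_ffun.
rewrite -[RHS]sum1_card (partition_big bd xpredT) //= mulnC -sum_nat_const.
apply: eq_bigr => y _.
have /exists_inP[g] := surj y; rewrite setCK => gS /eqP gy.
rewrite sum1dep_card.
have addgI : injective (fun f : chain => f + g) by apply: addIr.
rewrite -(card_imset (mem (flows_off S)) addgI); apply: eq_card => f.
apply/imsetP/idP => [[f0]|].
  rewrite in_set is_flowE => /andP[f0S /eqP f0b] ->.
  have gN : - g \in vanishing S by rewrite -sub0r vanishingB ?vanishing0.
  rewrite -[g]opprK in_set vanishingB //= bdB f0b -(subr0 g) opprB bdB bd0 gy.
  by rewrite !sub0r opprK.
rewrite in_set => /andP[fS /eqP fy].
exists (f - g); last by rewrite subrK.
by rewrite in_set vanishingB //= is_flowE bdB fy gy subrr.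
Qed.

Hypothesis Gamma_gt1 : (1 < #|Gamma|)%N.

(** The zero flow makes the number of flows positive, so the exponents can be compared. *)
Lemma card_off_le S : ~~ has_balanced_component (~: S) -> (#|S| + #|V| <= #|E|)%N.
Proof.
move/card_flows_off_mul => eqS.
have : (#|Gamma| ^ #|V| <= #|Gamma| ^ (#|E| - #|S|))%N.
  rewrite -eqS leq_pmull //; apply/card_gt0P; exists 0.
  by rewrite in_set vanishing0 is_flowE bd0 eqxx.
rewrite leq_exp2l // => le.
have SE : (#|S| <= #|E|)%N by apply: max_card.
by rewrite -(subnKC SE) leq_add2l.
Qed.

End Flows.

(** * Bonds and balanced components *)

Section Cuts.

Variable G : signed_graph.
Local Notation V := (vertex G).
Local Notation E := (edge G).
Implicit Types (F S B : {set E}) (X : {set V}).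

Lemma component_ofS F F' v :
  F \subset F' -> component_of F v \subset component_of F' v.
Proof.
move=> FF'; apply/subsetP => w; rewrite !inE; apply: connect_sub => x y.
case/exists_inP=> e eF xy; apply: connect1; apply/exists_inP; exists e => //.
exact: (subsetP FF').
Qed.

Lemma edges_inS F F' X X' :
  F \subset F' -> X \subset X' -> edges_in F X \subset edges_in F' X'.
Proof.
move=> FF' XX'; apply/subsetP => e; rewrite !inE => /andP[eF /forallP eX].
by rewrite (subsetP FF') //=; apply/forallP => b; apply: (subsetP XX').
Qed.

Lemma boundaryP X e b :
  (e \in boundary X) = ((endv (e, b) \in X) != (endv (e, ~~ b) \in X)).
Proof. by rewrite inE; case: b => //=; rewrite eq_sym. Qed.

Lemma component_of_boundary F v : boundary (component_of F v) \subset ~: F.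
Proof.
apply/subsetP => e; rewrite !inE; apply: contra => eF; apply/eqP.
have step b : connect (adj F) (endv (e, b)) (endv (e, ~~ b)).
  by apply: connect1; apply/exists_inP; exists e => //; apply/existsP; exists b;
    rewrite !eqxx.
by apply/idP/idP => cv; apply: (connect_trans cv (step _)).
Qed.

Lemma component_of_sub F X v :
  v \in X -> boundary X \subset ~: F -> component_of F v \subset X.
Proof.
move=> + bX; move=> vX; apply/subsetP => w; rewrite inE => /connectP[p].
elim: p v vX => [|u p IH] v vX /=; first by move=> _ ->.
case/andP=> /exists_inP[e eF /existsP[b /andP[/eqP ev /eqP eu]]]; apply: IH.
have : e \notin boundary X.
  by apply: contraL eF => /(subsetP bX); rewrite inE.
by rewrite (boundaryP X e b) negbK ev eu vX => /eqP <-.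
Qed.

Lemma has_balanced_componentP F :
  reflect (exists v, balanced (edges_in F (component_of F v)))
    (has_balanced_component F).
Proof.
apply: (iffP exists_inP) => [[_ /imsetP[v _ ->]]|[v bal]]; first by exists v.
by exists (component_of F v) => //; apply: imset_f.
Qed.

(** Once the cut is deleted, the component of a vertex of [X] cannot leave [X] and avoids [T], so it
    lies in the balanced graph G[X] - T. *)
Lemma cut_balanced_component B S :
  cut B -> B \subset S -> has_balanced_component (~: S).
Proof.
case/andP=> _ /existsP[X /existsP[T /and3P[X0 minT /eqP ->]]].
rewrite subUset => /andP[bS TS].
have /andP[_ bal] := minsetp minT; have [v vX] := set0Pn _ X0.
apply/has_balanced_componentP; exists v; apply: balancedS bal.
apply/subsetP => e eW.
have /subsetP/(_ e eW) : edges_in (~: S) (component_of (~: S) v) \subset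
    edges_in [set: E] X.
  by apply: edges_inS; [exact: subsetT | apply: component_of_sub => //; rewrite setCK].
rewrite in_setD => ->; rewrite andbT; apply: contraL eW => /(subsetP TS) eS.
by rewrite !inE eS.
Qed.

Lemma bond_cut B : bond B -> cut B.
Proof. by move/minsetp. Qed.

Hypothesis hcomp : ~~ has_balanced_component [set: E].

(** With [X] the vertex set of a balanced component, the edges of [S] inside [X] balance G[X]. A
    minimal balancing subset of them and the boundary of [X] form a cut inside [S]. *)
Lemma balanced_component_bond S :
  has_balanced_component (~: S) -> exists2 B, bond B & B \subset S.
Proof.
case/has_balanced_componentP=> v; set X := component_of _ v => bal.
pose p (T : {set E}) := (T \subset edges_in [set: E] X)
                        && balanced (edges_in [set: E] X :\: T).
have pS : p (edges_in S X).
  rewrite /p edges_inS ?subsetT //=; apply: balancedS bal.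
  apply/subsetP => e; rewrite !inE /= => /andP[eS eX]; move: eS.
  by rewrite eX !andbT.
have [T minT TS] := minset_exists pS.
have bS : boundary X \subset S by rewrite -[S]setCK component_of_boundary.
have vX : v \in X by rewrite inE connect0.
have cutB : cut (boundary X :|: T).
  apply/andP; split; last first.
    apply/existsP; exists X; apply/existsP; exists T; rewrite eqxx andbT.
    by apply/andP; split=> //; apply/set0Pn; exists v.
  (* If this set were empty, the component of [v] in the whole graph would be balanced. *)
  apply: contra hcomp; rewrite setU_eq0 => /andP[/eqP bX0 /eqP T0].
  apply/has_balanced_componentP; exists v.
  have := minsetp minT; rewrite /p T0 setD0 => /andP[_]; apply: balancedS.
  by apply: edges_inS => //; apply: component_of_sub => //; rewrite bX0 sub0set.
have [B minB BT] := minset_exists cutB; exists B => //.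
apply: (subset_trans BT); rewrite subUset bS; apply: (subset_trans TS).
by apply/subsetP => e; rewrite inE => /andP[].
Qed.

(** [phi] sends a component of G - e to the component of G containing it. The ends of [e] lie in
    different components of G - e with the same image, so one of them can be omitted without losing
    a component of G. *)
Lemma boundary1_cut_edge X e : boundary X = [set e] -> cut_edge e.
Proof.
move=> bX.
pose F := ~: [set e]; pose phi (C : {set V}) := \bigcup_(v in C) component_of [set: E] v.
have phiE w : phi (component_of F w) = component_of [set: E] w.
  apply/setP => u; apply/bigcupP/idP => [[v vw uv]|uw].
    have := subsetP (component_ofS w (subsetT F)) v vw.
    by move: uv; rewrite !inE => uv wv; apply: connect_trans wv uv.
  by exists w => //; rewrite inE connect0.
have [b eX eNX] : exists2 b, endv (e, b) \in X & endv (e, ~~ b) \notin X.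
  have : e \in boundary X by rewrite bX set11.
  rewrite inE; case e0: (endv (e, false) \in X); case e1: (endv (e, true) \in X) => // _.
    by exists false; rewrite ?e1.
  by exists true; rewrite ?e0.
set u := endv (e, b) in eX; set w := endv (e, ~~ b) in eNX.
have cuw : component_of [set: E] u = component_of [set: E] w.
  have uw : connect (adj [set: E]) u w.
    apply: connect1; apply/exists_inP; exists e; rewrite ?inE //.
    by apply/existsP; exists b; rewrite !eqxx.
  apply/setP => x; rewrite !inE.
  exact: (same_connect (@adj_sym _ _) uw).
have nuw : component_of F u != component_of F w.
  have uX : component_of F u \subset X by apply: component_of_sub; rewrite // bX setCK.
  apply: contra eNX => /eqP uw; apply: (subsetP uX).
  by rewrite uw inE connect0.
rewrite /cut_edge (cardsD1 (component_of F w) (components F)) imset_f //= add1n ltnS.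
apply: leq_trans (leq_imset_card phi _); apply: subset_leq_card.
apply/subsetP => _ /imsetP[x _ ->].
have [xw|xw] := eqVneq (component_of F x) (component_of F w).
  by rewrite -phiE xw phiE -cuw -phiE imset_f // in_setD1 nuw imset_f.
by rewrite -phiE imset_f // in_setD1 xw imset_f.
Qed.

Hypothesis bond_gt1 : forall B, bond B -> (1 < #|B|)%N.

(** As no bond is a singleton, the pair is a bond exactly when its deletion leaves a balanced
    component [X]. The boundary of [X] contains both edges, one or none of them: an edge cut, a cut
    edge, or [X] a full component of G. *)
Lemma bond_pairE (e e' : E) : e != e' -> bond [set e; e'] = sigma_pair e e'.
Proof.
move=> ee'.
have balE : bond [set e; e'] = has_balanced_component (~: [set e; e']).
  apply/idP/idP => [/bond_cut cutB|/balanced_component_bond[B bB BS]].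
    exact: cut_balanced_component cutB _.
  suff <- : B = [set e; e'] by [].
  by apply/eqP; rewrite eqEcard BS cards2 ee' bond_gt1.
rewrite balE; apply/idP/idP; last first.
  case/or3P=> [/andP[]|/andP[]|] //.
  case/exists_inP=> _ /imsetP[v _ ->] /andP[_ bal].
  apply/has_balanced_componentP; exists v; apply: balancedS bal.
  by apply: edges_inS => //; apply: component_ofS; apply: subsetT.
move=> hbal; case/has_balanced_componentP: (hbal) => v.
set X := component_of _ v => bal; apply/or3P.
have bS : boundary X \subset [set e; e'].
  by rewrite -[[set e; e']]setCK component_of_boundary.
have vX : v \in X by rewrite inE connect0.
case be: (e \in boundary X); case be': (e' \in boundary X).
- apply: Or32; rewrite hbal andbT; apply/existsP; exists X.
  by rewrite eqEsubset bS andbT subUset !sub1set be be'.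
- apply: Or31; rewrite hbal andbT; apply/orP; left; apply: (@boundary1_cut_edge X).
  apply/eqP; rewrite eqEsubset sub1set be andbT; apply/subsetP => x xX.
  by have := subsetP bS x xX; rewrite !inE => /orP[//|/eqP xe]; rewrite -xe xX in be'.
- apply: Or31; rewrite hbal andbT; apply/orP; right; apply: (@boundary1_cut_edge X).
  apply/eqP; rewrite eqEsubset sub1set be' andbT; apply/subsetP => x xX.
  by have := subsetP bS x xX; rewrite !inE => /orP[/eqP xe|//]; rewrite -xe xX in be.
have bX0 : boundary X = set0.
  apply/eqP; rewrite -subset0; apply/subsetP => x xX.
  by have := subsetP bS x xX; rewrite !inE => /orP[] /eqP xe; rewrite -xe xX in be be'.
apply: Or33.
(* If [a] lay outside [X], deleting [a'] alone would already leave a balanced component, giving a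
   bond with at most one edge. *)
have inX a a' : [set e; e'] = [set a; a'] -> a \notin boundary X -> 
    a \in edges_in [set: E] X.
  move=> aa' ba; apply: contraT => aX.
  have aXb c : endv (a, c) \notin X.
    apply: contra aX => cX; rewrite !inE /=; apply/forallP.
    have : endv (a, ~~ c) \in X by move: ba; rewrite (boundaryP X a c) cX negbK => /eqP <-.
    by move: cX; case: c => /= h1 h2 [].
  suff /balanced_component_bond[B /bond_gt1 B1 Ba'] :
      has_balanced_component (~: [set a']).
    by have := subset_leq_card Ba'; rewrite cards1 leqNgt B1.
  apply/has_balanced_componentP; exists v; apply: balancedS bal.
  have sX : component_of (~: [set a']) v \subset X.
    by apply: component_of_sub; rewrite // bX0 sub0set.
  apply/subsetP => x; rewrite aa' !inE => /andP[xa' /forallP xX].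
  apply/andP; split; last by apply/forallP => c; apply: (subsetP sX).
  rewrite negb_or xa' andbT; apply: contraNneq (aXb true) => <-.
  exact: (subsetP sX).
apply/exists_inP; exists (component_of [set: E] v); first exact: imset_f.
have -> : component_of [set: E] v = X.
  apply/eqP; rewrite eqEsubset andbC component_ofS ?subsetT //=.
  by apply: component_of_sub; rewrite // bX0 sub0set.
rewrite bal andbT subUset !sub1set; apply/andP; split.
  by apply: (@inX e e'); rewrite ?be.
by apply: (@inX e' e); rewrite ?be' // setUC.
Qed.

End Cuts.

(** * Broken bonds and the cancelling involution *)

Section BrokenBonds.

Variable G : signed_graph.
Local Notation V := (vertex G).
Local Notation E := (edge G).
Implicit Types (S B : {set E}).

Hypothesis hcomp : ~~ has_balanced_component [set: E].
Variable prec : rel E.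
Hypothesis precP : strict_linear_order prec.

Definition rank e := #|[set x | prec x e]|.

Lemma rank_lt d c : prec d c -> (rank d < rank c)%N.
Proof.
have [irr trans _] := precP; move=> dc; apply: proper_card.
apply/properP; split; last by exists d; rewrite inE ?dc ?irr.
by apply/subsetP => x; rewrite !inE => xd; apply: trans xd dc.
Qed.

Lemma rank_inj : injective rank.
Proof.
have [_ _ total] := precP; move=> e e' ee'; apply/eqP.
by apply: contraT => /total/orP[] /rank_lt; rewrite ee' ltnn.
Qed.

(** The missing maximum [b] is kept as a parameter because the involution toggles it. *)
Definition broken_at (b : E) S :=
  [exists B, [&& bond B, b \in B, [forall e in B, (e != b) ==> prec e b]
    & B :\ b \subset S]].

Lemma broken_atP b S : reflect
  (exists B, [/\ bond B, b \in B, forall e, e \in B -> e != b -> prec e b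
     & B :\ b \subset S])
  (broken_at b S).
Proof.
apply: (iffP existsP) => -[B]; [move/and4P|]; case=> bB bb.
  by move=> /forall_inP maxb sB; exists B; split=> // e /maxb/implyP.
move=> maxb sB; exists B; apply/and4P; split=> //.
by apply/forall_inP => e eB; apply/implyP; apply: maxb.
Qed.

Definition nbb S := [forall D : {set E}, broken_bond prec D ==> ~~ (D \subset S)].

Lemma nbbE S : nbb S = ~~ [exists b, broken_at b S].
Proof.
apply/forallP/negP => [nS /existsP[b /existsP[B /and4P[bondB bB maxb BS]]]|nS D].
  move/implyP: (nS (B :\ b)); rewrite BS => /(_ _)/negP; apply=> //.
  by apply/existsP; exists B; apply/exists_inP; exists b => //; apply/and3P.
apply/implyP => /existsP[B /exists_inP[b bB /and3P[bondB maxb /eqP ->]]].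
apply/negP => DS; apply: nS; apply/existsP; exists b; apply/existsP.
by exists B; apply/and4P.
Qed.

Lemma bond_max B : bond B -> exists2 b, b \in B
  & forall e, e \in B -> e != b -> prec e b.
Proof.
move=> bB; have [_ _ total] := precP.
have /andP[B0 _] := bond_cut bB; have [b0 b0B] := set0Pn _ B0.
case: (arg_maxnP rank b0B) => b bB' maxb; exists b => // e eB /total/orP[//|be].
by have := leq_ltn_trans (maxb e eB) (rank_lt be); rewrite ltnn.
Qed.

(** A balanced component of G - S gives a bond inside [S], and with it a broken bond. *)
Lemma nbb_unbalanced S : nbb S -> ~~ has_balanced_component (~: S).
Proof.
rewrite nbbE; apply: contra => /(balanced_component_bond hcomp)[B bondB BS].
have [b bB maxb] := bond_max bondB; apply/existsP; exists b; apply/broken_atP.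
by exists B; split=> //; apply: subset_trans BS; apply: subsetDl.
Qed.

Lemma nbbS S S' : S \subset S' -> nbb S' -> nbb S.
Proof.
move=> SS' /forallP nS'; apply/forallP => D; apply/implyP => bD.
by apply: contra (implyP (nS' D) bD) => DS; apply: subset_trans SS'.
Qed.

Lemma sdiff1K b : involutive (fun S => sdiff S [set b]).
Proof. by move=> S; apply/setP => e; rewrite !inE addbK. Qed.

Lemma sign_sdiff1 b S : (-1) ^+ #|sdiff S [set b]| = - (-1) ^+ #|S| :> int.
Proof.
have sU (T : {set E}) : b \notin T -> (-1) ^+ #|b |: T| = - (-1) ^+ #|T| :> int.
  by move=> bT; rewrite cardsU1 bT exprS mulN1r.
case bS: (b \in S).
  have -> : sdiff S [set b] = S :\ b.
    by apply/setP => e; rewrite !inE; case: eqP => [->|_]; rewrite ?bS ?addbF.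
  by rewrite -[in RHS](setD1K bS) sU ?opprK // !inE eqxx.
have -> : sdiff S [set b] = b |: S.
  by apply/setP => e; rewrite !inE; case: eqP => [->|_]; rewrite ?bS ?addbF.
by rewrite sU ?bS.
Qed.

(** Toggling [b] reverses the sign of each term, so the sum equals its own opposite. *)
Lemma toggle_sum0 b (P : pred {set E}) (w : {set E} -> nat) :
  (forall S, P (sdiff S [set b]) = P S) ->
  (forall S, P S -> w (sdiff S [set b]) = w S) ->
  \sum_(S | P S) (-1) ^+ #|S| * (w S)%:R = 0 :> int.
Proof.
move=> hP hw; set s := LHS; suff /eqP : s + s = 0.
  by rewrite -mulr2n Num.Theory.mulrn_eq0 => /eqP.
rewrite /s [X in X + _](reindex_inj (inv_inj (sdiff1K b))) /=.
rewrite [X in X + _](eq_bigl P) // -big_split big1 //= => S PS.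
by rewrite sign_sdiff1 hw // mulNr addNr.
Qed.

(* The set S is paired with its symmetric difference with {b}, where b is the
   smallest missing maximum of a broken bond contained in S; the choice of b is
   not affected, as broken bonds with smaller missing maximum avoid b. *)
Definition first_broken b S :=
  broken_at b S && [forall b', broken_at b' S ==> (rank b <= rank b')%N].

Lemma broken_at_sdiff b b' S : (rank b' <= rank b)%N ->
  broken_at b' (sdiff S [set b]) = broken_at b' S.
Proof.
move=> le; apply/broken_atP/broken_atP => -[B [bB b'B maxb' BS]];
  exists B; split=> //; apply/subsetP => e eB; have := subsetP BS e eB;
  move: eB; rewrite !inE => /andP[ne eB]; case: eqP => [eb|_]; rewrite ?addbF //;
  by move: le; rewrite -eb leqNgt rank_lt // maxb'.
Qed.

Lemma first_broken_sdiff b S :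
  first_broken b (sdiff S [set b]) = first_broken b S.
Proof.
rewrite /first_broken broken_at_sdiff //; congr (_ && _).
apply: eq_forallb => b'; case: leqP => lt; rewrite ?implybT //.
by rewrite broken_at_sdiff // ltnW.
Qed.

Lemma first_brokenP S : ~~ nbb S -> exists b, first_broken b S.
Proof.
rewrite nbbE negbK => /existsP[b0 b0S].
case: (@arg_minnP _ b0 (broken_at^~ S) rank b0S) => b bS minb; exists b; rewrite /first_broken bS.
by apply/forallP => b'; apply/implyP/minb.
Qed.

Lemma first_broken_inj b b' S : first_broken b S -> first_broken b' S -> b = b'.
Proof.
case/andP=> bS /forallP minb /andP[b'S /forallP minb']; apply: rank_inj.
by apply/eqP; rewrite eqn_leq (implyP (minb b')) // (implyP (minb' b)).
Qed.

Lemma broken_sum0 (w : {set E} -> nat) :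
  (forall b S, broken_at b S -> w (sdiff S [set b]) = w S) ->
  \sum_(S | ~~ nbb S) (-1) ^+ #|S| * (w S)%:R = 0 :> int.
Proof.
move=> hw.
(* Classes are indexed by the element to toggle; the class of [None] is empty, and each other class
   cancels by toggling. *)
rewrite (partition_big (fun S => [pick b | first_broken b S]) xpredT) //= big1 //.
move=> [b|] _; last first.
  apply: big_pred0 => S; case: pickP => [b _|none]; first by rewrite andbF.
  rewrite andbT; by apply: contraTF isT => nS; have [b] := first_brokenP nS; rewrite none.
rewrite (eq_bigl (first_broken b)) => [|S].
  apply: (@toggle_sum0 b) => S; first exact: first_broken_sdiff.
  by case/andP=> bS _; apply: hw.
case: pickP => [b' b'S|none].
  apply/andP/idP => [[_ /eqP[<-]] //|bS]; split.
    rewrite nbbE negbK; apply/existsP; exists b; by case/andP: bS.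
  by rewrite (first_broken_inj bS b'S).
by rewrite andbF none.
Qed.

End BrokenBonds.

(** * The alternating sum over sets without broken bonds *)

Section Expansion.

Variables (G : signed_graph) (Gamma : finZmodType) (o : edge G * bool -> bool).
Hypotheses (oddG : odd #|Gamma|) (oP : orientation o).
Local Notation V := (vertex G).
Local Notation E := (edge G).
Local Notation chain := {ffun E -> Gamma}.
Implicit Types (S T B : {set E}) (f g : chain).

(** After exchanging the sums, a flow contributes the signed count of subsets of its zero set: 1 if
    it has no zero, and 0 otherwise by toggling one of its zeros. *)
Lemma nowhere_zero_inclusion_exclusion :
  (#|nowhere_zero_flows Gamma o|)%:R
  = \sum_(S : {set E}) (-1) ^+ #|S| * (#|flows_off Gamma o S|)%:R :> int.
Proof.
pose nz f := [forall e, f e != 0].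
have inner f : \sum_(S | f \in vanishing Gamma S) (-1) ^+ #|S| = (nz f)%:R :> int.
  have [/forallP nzf|] := boolP (nz f).
    rewrite (big_pred1 set0) ?cards0 // => S; apply/vanishingP/eqP => [fS|->].
      apply/setP => e; rewrite inE; apply/negP => /fS fe.
      by have := nzf e; rewrite fe eqxx.
    by move=> e; rewrite inE.
  rewrite negb_forall => /existsP[b]; rewrite negbK => /eqP fb.
  rewrite -[RHS](@toggle_sum0 G b [pred S | f \in vanishing Gamma S] (fun=> 1%N)) //=.
    by apply: eq_bigr => S _; rewrite mulr1.
  move=> S; apply/vanishingP/vanishingP => fS e eS; have [->//|ne] := eqVneq e b;
    by apply: fS; rewrite ?inE ?(negPf ne) ?addbF // in eS *.
transitivity (\sum_(f : chain | is_flow o f)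
   \sum_(S | f \in vanishing Gamma S) (-1) ^+ #|S| : int).
  under eq_bigr do rewrite inner.
  rewrite -sum1_card natr_sum big_mkcond [RHS]big_mkcond; apply: eq_bigr => f _.
  by rewrite inE -/(nz f); case: (is_flow o f); case: (nz f).
rewrite (exchange_big_dep xpredT) //=; apply: eq_bigr => S _.
rewrite sumr_const mulr_natr; congr (_ *+ _).
by apply: eq_card => f; rewrite in_set andbC.
Qed.

Hypothesis hcomp : ~~ has_balanced_component [set: E].
Variable prec : rel E.
Hypothesis precP : strict_linear_order prec.

Lemma flow_bond_vanish B b f S : bond B -> b \in B -> B :\ b \subset S ->
  f \in flows_off Gamma o S -> f b = 0.
Proof.
move=> /bond_cut cutB bB /subsetP BS; rewrite in_set => /andP[/vanishingP fS fl].
by apply: (flow_cut oddG oP cutB bB fl); apply/vanishingP => e /BS /fS.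
Qed.

(** Vanishing on the broken bond already forces a flow to vanish at [b], whether or not [b] is in
    [S]. *)
Lemma flows_off_sdiff b S : broken_at prec b S ->
  #|flows_off Gamma o (sdiff S [set b])| = #|flows_off Gamma o S|.
Proof.
case/broken_atP=> B [bondB bB maxb BS].
have BS' : B :\ b \subset sdiff S [set b].
  apply/subsetP => e eB; have eS := subsetP BS e eB.
  by move: eB; rewrite !inE eS => /andP[/negPf ->].
have sub T T' : B :\ b \subset T -> T' \subset b |: T ->
    flows_off Gamma o T \subset flows_off Gamma o T'.
  move=> BT T'T; apply/subsetP => f fT; have fb := flow_bond_vanish bondB bB BT fT.
  move: fT; rewrite in_set => /andP[/vanishingP fT fl]; rewrite in_set fl andbT.
  apply/vanishingP => e /(subsetP T'T); rewrite !inE => /predU1P[->//|]; exact: fT.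
apply/eqP; rewrite eqn_leq !subset_leq_card // sub //; apply/subsetP => e;
  by rewrite !inE; case: eqP; rewrite //= addbF.
Qed.

Lemma nowhere_zero_broken_bonds :
  (#|nowhere_zero_flows Gamma o|)%:R
  = \sum_(S | nbb prec S) (-1) ^+ #|S| * (#|flows_off Gamma o S|)%:R :> int.
Proof.
rewrite nowhere_zero_inclusion_exclusion (bigID (nbb prec)) /=.
rewrite [X in _ + X](broken_sum0 precP) ?addr0 // => b S.
exact: flows_off_sdiff.
Qed.

Lemma Gamma_gt0 : (0 < #|Gamma|)%N.
Proof. by apply/card_gt0P; exists 0. Qed.

Lemma card_flows_off S : (#|S| + #|V| <= #|E|)%N ->
  ~~ has_balanced_component (~: S) ->
  #|flows_off Gamma o S| = (#|Gamma| ^ (#|E| - #|V| - #|S|))%N.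
Proof.
move=> le /(card_flows_off_mul oddG oP) eqS; apply/eqP.
rewrite -(@eqn_pmul2r (#|Gamma| ^ #|V|)) ?expn_gt0 ?Gamma_gt0 // eqS -expnD.
by rewrite subnAC subnK // leq_subRL ?max_card.
Qed.

(** * Cobases and sets of full size without broken bonds *)

Section Admissible.

Variable g : chain.
Hypothesis gP : g \in nowhere_zero_flows Gamma o.

(** Every flow vanishes on a one-element bond, but [g] has no zero. *)
Lemma bond_gt1_of_flow B : bond B -> (1 < #|B|)%N.
Proof.
move=> bB; have /andP[B0 _] := bond_cut bB; have [b bB'] := set0Pn _ B0.
rewrite (cardsD1 b) bB' ltnS card_gt0; apply/eqP => Bb0.
move: gP; rewrite inE => /andP[fl /forallP/(_ b)/eqP]; apply.
by apply: (@flow_bond_vanish B b g set0); rewrite ?Bb0 // in_set fl andbT;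
  apply/vanishingP => e; rewrite inE.
Qed.

Hypothesis Gamma_gt1 : (1 < #|Gamma|)%N.

Let N := (#|E| - #|V|)%N.

(* Complements of bases of the signed-graphic matroid. *)
Definition cobase T := (#|T| == N) && [forall f in flows_off Gamma o T, f == 0].

Lemma cobaseP T : reflect
  (#|T| = N /\ forall f, f \in flows_off Gamma o T -> f = 0) (cobase T).
Proof.
apply: (iffP andP) => -[].
  by move=> /eqP cT /forall_inP fT; split=> // f /fT/eqP.
by move=> -> fT; split=> //; apply/forall_inP => f /fT ->.
Qed.

(** Take [S] maximal such that G - S has no balanced component. Adding any further [c] creates a
    bond through [c], so a flow vanishing on [S] vanishes everywhere; having a single such flow
    forces |S| = N. *)
Lemma exists_cobase : exists T, cobase T.
Proof.
pose p S := ~~ has_balanced_component (~: S).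
have p0 : p set0 by rewrite /p setC0.
have [S /maxsetP[pS maxS] _] := maxset_exists p0.
have fl0 f : f \in flows_off Gamma o S -> f = 0.
  move=> fS; apply/ffunP => c; rewrite [RHS]ffunE.
  have [cS|cS] := boolP (c \in S).
    by move: fS; rewrite in_set => /andP[/vanishingP ->].
  have : has_balanced_component (~: (c |: S)).
    apply: contraNT cS => pcS; rewrite -(maxS _ pcS) ?subsetUr //.
    by rewrite setU11.
  case/(balanced_component_bond hcomp) => B bondB BS.
  have Bc : B :\ c \subset S by rewrite subDset.
  have cB : c \in B.
    apply: contraR pS => cB; apply: (cut_balanced_component (bond_cut bondB)).
    by apply: subset_trans Bc; rewrite subsetD1 subxx.
  exact: flow_bond_vanish bondB cB Bc fS.
exists S; apply/cobaseP; split=> //.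
have le := card_off_le oddG oP Gamma_gt1 pS.
have := card_flows_off le pS.
have -> : #|flows_off Gamma o S| = 1%N.
  apply/eqP/cards1P; exists 0; apply/setP => f; rewrite in_set1.
  apply/idP/eqP => [/fl0 //|->].
  by rewrite in_set vanishing0 is_flowE bd0 eqxx.
move/eqP; rewrite eq_sym -(expn0 #|Gamma|) eqn_exp2l // subn_eq0 => le'.
by apply/eqP; rewrite eqn_leq le' andbT leq_subRL 1?addnC // (leq_trans _ le) // leq_addl.
Qed.

(** Restriction to [T] is injective on flows, and flows are as numerous as the functions on [T]. *)
Lemma cobase_surj T (y : chain) : cobase T ->
  exists2 f, is_flow o f & forall e, e \in T -> f e = y e.
Proof.
case/cobaseP=> cT fl0.
pose r f : chain := [ffun e => if e \in T then f e else 0].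
have r_inj : {in flows_off Gamma o set0 &, injective r}.
  move=> f f'; rewrite in_set => /andP[_ flf]; rewrite in_set => /andP[_ flf'] /ffunP rr.
  apply/eqP; rewrite -subr_eq0; apply/eqP; apply: fl0; rewrite in_set.
  apply/andP; split.
    by apply/vanishingP => e eT; have := rr e; rewrite !ffunE eT => ->; rewrite subrr.
  by rewrite is_flowE bdB; move: flf flf'; rewrite !is_flowE => /eqP -> /eqP ->; rewrite subrr.
have p0 : ~~ has_balanced_component (~: set0 : {set E}) by rewrite setC0.
have le := card_off_le oddG oP Gamma_gt1 p0.
have rE : r @: flows_off Gamma o set0 = vanishing Gamma (~: T).
  apply/eqP; rewrite eqEcard; apply/andP; split.
    apply/subsetP => _ /imsetP[f _ ->]; apply/vanishingP => e.
    by rewrite inE ffunE => /negPf ->.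
  rewrite (card_in_imset r_inj) card_flows_off // cards0 subn0 card_vanishing.
  by rewrite -cardsCs cT.
have : r y \in vanishing Gamma (~: T).
  by apply/vanishingP => e; rewrite inE ffunE => /negPf ->.
rewrite -rE => /imsetP[f]; rewrite in_set => /andP[_ fl] /ffunP rf.
by exists f => // e eT; have := rf e; rewrite !ffunE eT.
Qed.

Lemma cobase_exchange T B b d : cobase T -> bond B -> b \in B -> B :\ b \subset T ->
  d \in B :\ b -> b \notin T /\ cobase (b |: (T :\ d)).
Proof.
move=> cobT bondB bB BT dB.
have bT : b \notin T.
  apply/negP => bT.
  (* This flow is nonzero at [b] but vanishes on the rest of [T], hence on the rest of the bond,
     which is impossible. *)
  have [f fl fT] := cobase_surj [ffun e => if e == b then g b else 0] cobT.
  have : f \in flows_off Gamma o (B :\ b).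
    rewrite in_set fl andbT; apply/vanishingP => e eB.
    by rewrite fT ?(subsetP BT) // ffunE; case: eqP eB => // ->; rewrite !inE eqxx.
  move/(flow_bond_vanish bondB bB (subxx _)); rewrite fT // ffunE eqxx => gb.
  by move: gP; rewrite inE => /andP[_ /forallP/(_ b)]; rewrite gb eqxx.
have dT := subsetP BT d dB; have /setD1P[db dB'] := dB.
split=> //; have /cobaseP[cT fl0] := cobT; apply/cobaseP; split.
  by rewrite cardsU1 !inE (negPf bT) andbF -cT [in RHS](cardsD1 d) dT.
move=> f fT'; apply: fl0.
(* The new set contains [B] except for [d], so the bond forces the value at [d] to vanish as
   well. *)
have fd : f d = 0.
  apply: (flow_bond_vanish bondB dB' _ fT'); apply/subsetP => e; rewrite !inE.
  case/andP=> -> eB; case: eqVneq => //= eb.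
  by apply: (subsetP BT); rewrite !inE eb.
move: fT'; rewrite in_set => /andP[/vanishingP fT' fl]; rewrite in_set fl andbT.
apply/vanishingP => e eT; have [->//|ed] := eqVneq e d.
by apply: fT'; rewrite !inE ed eT orbT.
Qed.

(* A cobase maximising the sum of the ranks contains no broken bond B - b, since
   exchanging any element of B - b for b would increase that sum. *)
Lemma exists_nbb : exists2 S, nbb prec S & #|S| = N.
Proof.
have [T0 cobT0] := exists_cobase.
case: (@arg_maxnP _ T0 cobase (fun T => \sum_(e in T) rank prec e)%N cobT0) => T cobT maxT.
exists T; last by case/cobaseP: cobT.
rewrite nbbE; apply/existsP => -[b /broken_atP[B [bondB bB maxb BT]]].
have /card_gt0P[d dB] : (0 < #|B :\ b|)%N.
  by have := bond_gt1_of_flow bondB; rewrite (cardsD1 b) bB.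
have [bT cobT'] := cobase_exchange cobT bondB bB BT dB.
have := maxT _ cobT'; rewrite /= /geq /= big_setU1 ?inE ?(negPf bT) ?andbF //=.
rewrite [X in (_ <= X)%N -> _](big_setD1 d) ?(subsetP BT) //= leq_add2r leqNgt.
by move: dB; rewrite !inE => /andP[db dB]; rewrite rank_lt // maxb.
Qed.

End Admissible.

End Expansion.

(** * Identification of the polynomial and of its coefficients *)

Lemma poly_eq_odd (P Q : {poly int}) :
  (forall i : nat, P.[(i.*2.+1)%:R] = Q.[(i.*2.+1)%:R]) -> P = Q.
Proof.
move=> eqPQ; apply/eqP; rewrite -subr_eq0; apply: contraT => nz.
(* These are [size (P - Q)] distinct roots, one more than the degree allows. *)
pose rs := [seq (i.*2.+1)%:R : int | i <- iota 0 (size (P - Q))].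
have := max_poly_roots (rs := rs) nz; rewrite size_map size_iota ltnn.
apply.
  by apply/allP => _ /mapP[i _ ->]; rewrite rootE hornerD hornerN eqPQ subrr.
rewrite map_inj_uniq ?iota_uniq // => i j /eqP; rewrite Num.Theory.eqr_nat eqSS.
by move/eqP/double_inj.
Qed.

(** The cyclic groups on ['I_(i.*2.+1)] realise every odd order, so the flow counts determine the
    polynomial. *)
Lemma F0_unique (G : signed_graph) (o : edge G * bool -> bool) (P : {poly int}) :
  orientation o -> is_F0 G P -> F0 G = P.
Proof.
move=> oP hP; have hF : is_F0 G (F0 G) by apply: epsilon_spec; exists P.
apply: poly_eq_odd => i.
have card_odd : odd #|'I_(i.*2.+1)| by rewrite card_ord /= odd_double.
by have := hF _ o card_odd oP; rewrite (hP _ o card_odd oP) card_ord.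
Qed.

Theorem corollary5p4 (Gamma : finZmodType) (hGamma : odd #|Gamma|)
    (G : signed_graph) (n m : nat)
    (hn : #|vertex G| = n) (hm : #|edge G| = m)
    (hunb : unbalanced [set: edge G])
    (hcomp : ~~ has_balanced_component [set: edge G])
    (hadm : flow_admissible G Gamma)
    (prec : rel (edge G)) (hprec : strict_linear_order prec) :
  [/\ (n <= m)%N,
      F0 G = \sum_(i < (m - n).+1)
               ((-1) ^+ i * (nbb_count prec i)%:R) *: 'X^(m - n - i),
      forall i : nat, (i <= m - n)%N -> (0 < nbb_count prec i)%N,
      nbb_count prec 0 = 1%N
    & (nbb_count prec 1 = m - sigma prec)%N].
Proof.
subst n m; have [o oP /set0Pn[g gP]] := hadm.
(* An unbalanced circuit has an edge, at which [g] takes a nonzero value. *)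
have Gamma_gt1 : (1 < #|Gamma|)%N.
  have /existsP[C /and3P[_ /and3P[/set0Pn[e _] _ _] _]] := hunb.
  apply/card_gt1P; exists (g e), 0; split=> //.
  by move: gP; rewrite inE => /andP[_ /forallP].
have bond2 := bond_gt1_of_flow hGamma oP gP.
have off_le S : nbb prec S -> (#|S| + #|vertex G| <= #|edge G|)%N.
  move=> nS; apply: (card_off_le hGamma oP Gamma_gt1).
  exact: nbb_unbalanced nS.
have nbb_gt0 i : (i <= #|edge G| - #|vertex G|)%N -> (0 < nbb_count prec i)%N.
  move=> le_i; have [S nS cS] := exists_nbb hGamma oP hcomp hprec gP Gamma_gt1.
  have : (0 < #|[set T : {set edge G} | T \subset S & #|T| == i]|)%N.
    by rewrite cards_draws bin_gt0 cS.
  case/card_gt0P=> T; rewrite inE => /andP[TS cT]; apply/card_gt0P; exists T.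
  by rewrite inE cT; apply: nbbS TS nS.
have nbb0 : nbb_count prec 0 = 1%N.
  have -> : nbb_count prec 0 = #|[set (set0 : {set edge G})]|.
    apply: eq_card => S; rewrite !inE cards_eq0; case: eqP => //= ->.
    rewrite -[LHS]/(nbb prec set0) nbbE.
    apply/existsP => -[b /broken_atP[B [/bond2 + bB _]]].
    by rewrite subset0 (cardsD1 b) bB => + /eqP Bb; rewrite Bb cards0.
  exact: cards1.
split=> //.
- have := off_le set0; rewrite cards0 add0n; apply.
  have : (0 < nbb_count prec 0)%N by rewrite nbb0.
  by case/card_gt0P=> S; rewrite inE cards_eq0 => /andP[/eqP ->].
(* The bound [off_le], obtained from [Gamma], concerns only the graph, so it serves for every
   [Gamma'], even the trivial group. *)
- apply: (F0_unique oP) => Gamma' o' odd' o'P.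
  rewrite (nowhere_zero_broken_bonds odd' o'P hprec) horner_sum.
  pose N := (#|edge G| - #|vertex G|)%N.
  have card_le S : nbb prec S -> (#|S| <= N)%N.
    by move=> /off_le le; rewrite leq_subRL 1?addnC // (leq_trans _ le) // leq_addl.
  (* Sets are sorted by size; [inord] is faithful here because of [card_le]. *)
  rewrite (partition_big (fun S : {set edge G} => inord #|S| : 'I_N.+1) xpredT) //=.
  apply: eq_bigr => i _; rewrite hornerZ hornerXn -mulrA.
  rewrite (eq_bigr (fun=> (-1) ^+ i * (#|Gamma'|%:R ^+ (N - i)))) => [|S /andP[nS /eqP iE]].
    rewrite sumr_const -mulrnAr -mulr_natl; congr (_ * (_%:R * _)).
    apply: eq_card => S; rewrite [RHS]inE andbC; apply: andb_id2l => nS.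
    by rewrite -val_eqE /= inordK // ltnS card_le.
  have -> : i = #|S| :> nat by rewrite -iE inordK // ltnS card_le.
  by rewrite (card_flows_off odd' o'P (off_le S nS)) ?natrX //; apply: nbb_unbalanced nS.
(* Bonds have at least two edges, so [[set e]] contains a broken bond exactly when [e] is the
   smaller element of a two-edge bond. *)
rewrite -(cardsC [set e | [exists e', prec e e' && sigma_pair e e']]).
rewrite -/(sigma prec) addKn -(card_imset _ (@set1_inj (edge G))).
apply: eq_card => S; apply/idP/imsetP => [|[e]].
  rewrite inE => /andP[/cards1P[e ->] nS]; exists e => //; rewrite !inE.
  move: nS; rewrite -[X in is_true X -> _]/(nbb prec [set e]) nbbE.
  apply: contra => /existsP[e' /andP[ee' se]]; apply/existsP; exists e'.
  have [irr trans _] := hprec.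
  have ne : e != e' by apply: contraTneq ee' => ->; rewrite irr.
  apply/broken_atP; exists [set e; e']; split.
  - by rewrite (bond_pairE hcomp bond2).
  - by rewrite !inE eqxx orbT.
  - by move=> x; rewrite !inE => /orP[/eqP -> //|->].
  - by apply/subsetP => x; rewrite !inE => /andP[/negPf ->]; rewrite orbF.
rewrite !inE => nS ->; rewrite cards1 eqxx /=.
rewrite -[X in is_true X]/(nbb prec [set e]) nbbE.
apply: contra nS => /existsP[b /broken_atP[B [bondB bB maxb Bbe]]].
have Bb : B :\ b = [set e].
  apply/eqP; rewrite eqEcard Bbe cards1.
  by have := bond2 B bondB; rewrite (cardsD1 b) bB.
have /setD1P[eb eB] : e \in B :\ b by rewrite Bb set11.
apply/existsP; exists b; rewrite maxb //=.
by rewrite -(bond_pairE hcomp bond2) // setUC -Bb setD1K.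
Qed.
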